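(* Let $\mathcal{H}$ be a separable complex Hilbert space, let $\Lambda=\{\Lambda_i\}_{i\in J}$, $\Lambda_i\in\mathcal{L}(\mathcal{H},\mathcal{H}_i)$, be a g-frame for $\mathcal{H}$ with lower and upper g-frame bounds $A_\Lambda,B_\Lambda$, and let $\Theta=\{\Theta_i\}_{i\in J}$, $\Theta_i\in\mathcal{L}(\mathcal{H},\mathcal{H}_i)$. Assume that $\Theta-\Lambda=\{\Theta_i-\Lambda_i\}_{i\in J}$ is a g-Bessel sequence for $\mathcal{H}$ with bound $B_{\Theta-\Lambda}<\frac{A_\Lambda^2}{B_\Lambda}$. Then for every positive (or negative) semi-normalized sequence $m=(m_i)_{i\in J}$ satisfying $$0<a\le|m_i|\le b\ \text{ for all } i,\quad\text{and}\quad\frac ba<\frac{A_\Lambda}{\sqrt{B_{\Theta-\Lambda}B_\Lambda}},$$ it follows that $\Theta$ is a g-frame for $\mathcal{H}$, the multipliers $M_{m,\Lambda,\Theta}$ and $M_{m,\Theta,\Lambda}$ are invertible on $\mathcal{H}$, $$\frac{1}{bB_\Lambda+b\sqrt{B_\Lambda B_{\Theta-\Lambda}}}\|h\|\le\|M^{-1}_{m,\Lambda,\Theta}h\|\le\frac{1}{aA_\Lambda-b\sqrt{B_\Lambda B_{\Theta-\Lambda}}}\|h\|\quad\text{for all }h\in\mathcal{H},$$ and the same inequalities hold for $\|M^{-1}_{m,\Theta,\Lambda}h\|$. Moreover, $$M^{-1}_{m,\Lambda,\Theta}=\begin{cases}\sum_{k=0}^{\infty}\big[S^{-1}_{(\sqrt{m_i}\Lambda_i)}\big(S_{(\sqrt{m_i}\Lambda_i)}-M_{m,\Lambda,\Theta}\big)\big]^kS^{-1}_{(\sqrt{m_i}\Lambda_i)},&\text{if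 } m_i>0\ \text{for all } i,\\-\sum_{k=0}^{\infty}\big[S^{-1}_{(\sqrt{|m_i|}\Lambda_i)}\big(S_{(\sqrt{|m_i|}\Lambda_i)}+M_{m,\Lambda,\Theta}\big)\big]^kS^{-1}_{(\sqrt{|m_i|}\Lambda_i)},&\text{if } m_i<0\ \text{for all } i,\end{cases}$$ $$M^{-1}_{m,\Theta,\Lambda}=\begin{cases}\sum_{k=0}^{\infty}\big[S^{-1}_{(\sqrt{m_i}\Lambda_i)}\big(S_{(\sqrt{m_i}\Lambda_i)}-M_{m,\Theta,\Lambda}\big)\big]^kS^{-1}_{(\sqrt{m_i}\Lambda_i)},&\text{if } m_i>0\ \text{for all } i,\\-\sum_{k=0}^{\infty}\big[S^{-1}_{(\sqrt{|m_i|}\Lambda_i)}\big(S_{(\sqrt{|m_i|}\Lambda_i)}+M_{m,\Theta,\Lambda}\big)\big]^kS^{-1}_{(\sqrt{|m_i|}\Lambda_i)},&\text{if } m_i<0\ \text{for all } i.\end{cases}$$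
   Context: $J\subseteq\mathbb{Z}$ is an index set, $\{\mathcal{H}_i\}_{i\in J}$ is a sequence of separable complex Hilbert spaces, and $\mathcal{L}(\mathcal{H},\mathcal{H}_i)$ is the set of bounded linear operators $\mathcal{H}\to\mathcal{H}_i$. A family $\{\Lambda_i\}_{i\in J}$, $\Lambda_i\in\mathcal{L}(\mathcal{H},\mathcal{H}_i)$, is a g-frame for $\mathcal{H}$ with lower and upper bounds $A,B>0$ if $A\|f\|^2\le\sum_{i\in J}\|\Lambda_if\|^2\le B\|f\|^2$ for all $f\in\mathcal{H}$; it is a g-Bessel sequence with bound $B>0$ if the upper inequality holds. The g-frame operator of a g-frame is $S_{(\Lambda_i)}f=\sum_{i\in J}\Lambda_i^{\star}\Lambda_if$, a bounded, positive, invertible operator; $S_{(\sqrt{|m_i|}\Lambda_i)}$ is the g-frame operator of $\{\sqrt{|m_i|}\Lambda_i\}_{i\in J}$. The multiplier is $M_{m,\Lambda,\Theta}f=\sum_{i\in J}m_i\Lambda_i^{\star}\Theta_if$. A sequence is semi-normalized if $a\le|m_i|\le b$ for all $i$ and some $b\ge a>0$; it is positive (negative) if all $m_i$ are real and $>0$ ($<0$). *)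

(* Defs.v *)
From HB Require Import structures.
From mathcomp Require Import all_boot all_order all_algebra.
From mathcomp Require Import all_classical all_reals all_analysis.
From mathcomp Require Import complex.

Set Implicit Arguments.
Unset Strict Implicit.
Unset Printing Implicit Defensive.

Import Order.TTheory GRing.Theory Num.Theory.
Import numFieldNormedType.Exports.

Local Open Scope classical_set_scope.
Local Open Scope complex_scope.
Local Open Scope ring_scope.

(* The dot product is linear in its first argument and conjugate-linear in the
   second one. *)
HB.mixin Record CompleteNormedModule_isHilbert (R : realType) H
    & CompleteNormedModule R[i] H := {
  hdot : {dot H for @Num.conj R[i]} ;
  hdot_norm : forall x : H, `|x| ^+ 2 = hdot x x
}.

#[short(type="hilbertType")]
HB.structure Definition Hilbert (R : realType) :=
  {H of CompleteNormedModule R[i] H & CompleteNormedModule_isHilbert R H}.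

Definition separable (T : topologicalType) : Prop :=
  exists2 D : set T, countable D & dense D.

(* Norms over R[i] take their values in R[i], on the nonnegative real axis;
   rnorm is the same norm seen as an element of R. *)
Definition rnorm (R : realType) (V : normedZmodType R[i]) (x : V) : R :=
  complex.Re `|x|.

Section Operators.
Variables (R : realType) (H K : hilbertType R).

Definition bounded_op (T : H -> K) : Prop :=
  linear T /\ exists C : R, forall x : H, rnorm (T x) <= C * rnorm x.

(* By the Riesz representation theorem exactly one z satisfies the condition
   when T is a bounded operator. *)
Definition adjoint (T : H -> K) (y : K) : H :=
  xget 0 [set z : H | forall x : H, hdot (T x) y = hdot x z].

Definition opnorm (T : H -> K) : \bar R :=
  ereal_sup [set (rnorm (T x))%:E | x in [set x : H | rnorm x <= 1]].

(* The operator series \sum_k u_k converges to T in operator norm. *)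
Definition has_opsum (u : nat -> H -> K) (T : H -> K) : Prop :=
  opnorm (fun x => \sum_(k < n) u k x - T x) @[n --> \oo] --> 0%E.

End Operators.

Section Invertibility.
Variables (R : realType) (H : hilbertType R).

Definition invertible_op (T : H -> H) : Prop :=
  bounded_op T /\
  exists T' : H -> H, [/\ bounded_op T', cancel T T' & cancel T' T].

(* The inverse of T when T is bijective; junk otherwise. *)
Definition opinv (T : H -> H) (y : H) : H := xget 0 [set x : H | T x = y].

End Invertibility.

(* The directed set of the finite subsets of J: convergence along it is
   unconditional convergence of a series indexed by J. *)
Definition finite_subsets (I : choiceType) (J : set I) : set_system (set I) :=
  filter_from (fsets J) (fun A0 => [set A | fsets J A /\ A0 `<=` A]).

Section GFrames.
Variables (R : realType) (H : hilbertType R) (K : int -> hilbertType R).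
Variable J : set int.
Implicit Types Lam The : forall i : int, H -> K i.
Implicit Type m : int -> R[i].

(* Families are indexed by all of int, but only their members with index in J
   are ever constrained or used. *)
Definition g_bessel Lam (B : R) : Prop :=
  [/\ forall i, J i -> bounded_op (Lam i), 0 < B &
      forall f : H,
        (\esum_(i in J) (rnorm (Lam i f) ^+ 2)%:E <= (B * rnorm f ^+ 2)%:E)%E].

Definition g_frame Lam (A B : R) : Prop :=
  [/\ forall i, J i -> bounded_op (Lam i), 0 < A, 0 < B &
      forall f : H,
        ((A * rnorm f ^+ 2)%:E <= \esum_(i in J) (rnorm (Lam i f) ^+ 2)%:E
                               <= (B * rnorm f ^+ 2)%:E)%E].

Definition is_g_frame Lam : Prop := exists A B : R, g_frame Lam A B.

Definition frame_op Lam (f : H) : H :=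
  lim (\sum_(i \in F) adjoint (Lam i) (Lam i f) @[F --> finite_subsets J]).

Definition multiplier_sum m Lam The (f : H) (F : set int) : H :=
  \sum_(i \in F) m i *: adjoint (Lam i) (The i f).

Definition multiplier m Lam The (f : H) : H :=
  lim (multiplier_sum m Lam The f @ finite_subsets J).

Definition multiplier_cvg m Lam The : Prop :=
  forall f : H, cvg (multiplier_sum m Lam The f @ finite_subsets J).

Definition semi_normalized m (a b : R) : Prop :=
  [/\ 0 < a, a <= b & forall i, J i -> a <= rnorm (m i) <= b].

(* In the partial order of R[i], 0 < z means that z is real and positive. *)
Definition positive_seq m : Prop := forall i, J i -> 0 < m i.
Definition negative_seq m : Prop := forall i, J i -> m i < 0.

Definition scaled_family (c : int -> R[i]) Lam : forall i : int, H -> K i :=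
  fun i f => c i *: Lam i f.

End GFrames.

(* Main.v *)
Require Import Defs.
From HB Require Import structures.
From mathcomp Require Import all_boot all_order all_algebra.
From mathcomp Require Import all_classical all_reals all_analysis.
From mathcomp Require Import complex.
From mathcomp Require Import ring lra.

Set Implicit Arguments.
Unset Strict Implicit.
Unset Printing Implicit Defensive.

Import Order.TTheory GRing.Theory Num.Theory.
Import numFieldNormedType.Exports.

Local Open Scope classical_set_scope.
Local Open Scope complex_scope.
Local Open Scope ring_scope.

(* With the real inner product [Re <x, y>], [H] is a real Hilbert space, and all
   the estimates live there. Replacing m by -m, one may assume m > 0. Then
   S = S_(sqrt m_i Lam_i) is M_(m, Lam, Lam), so that <S f, f> >= a A |f|^2, and
   M_(m, Lam, The) - S = M_(m, Lam, The - Lam) has norm at most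
   d = b sqrt (B BD) < a A by the Cauchy-Schwarz inequality. Hence M_(m, Lam, The)
   is coercive with constant a A - d, which gives invertibility (Lax-Milgram) and
   the bounds on the inverse; the Neumann series converges since
   |S^-1 (S - M)| <= d / (a A) < 1. The same holds for M_(m, The, Lam). *)

(** [adjoint], [opinv], [frame_op] and [multiplier] are total functions defined by a choice or a
    limit, so they mean something only once existence is shown: Riesz representation for the
    adjoint, coercivity for the inverse, unconditional convergence for the sums over [J]. The
    convergence comes from the same Cauchy-Schwarz estimate as the norm bounds, applied to finite
    sets disjoint from a large one: there the square sum of one family is small while the other
    family keeps its Bessel bound. Taking real parts costs nothing: the norm is unchanged,
    coercivity of Re <M f, f> is all that Lax-Milgram uses, and every inequality then lives in the
    total order of [R]. Only the complex adjoint identity has to be recovered from its real part.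
    The assumption on [b / a] is exactly d < a A with the denominators cleared. Both multipliers
    share the same d because Cauchy-Schwarz is symmetric in the two families. *)

(** * Real inner product, norm and convergence *)

Section RealInnerProduct.
Variables (R : realType) (H : hilbertType R).
Implicit Types x y z : H.

Definition rdot x y : R := complex.Re (hdot x y).

Lemma rnormE x : `|x| = (rnorm x)%:C.
Proof. by rewrite /rnorm RRe_real// ger0_real. Qed.

Lemma rnorm_ge0 x : 0 <= rnorm x.
Proof. by rewrite -ler0c -rnormE. Qed.

Lemma rnorm0 : rnorm (0 : H) = 0.
Proof. by rewrite /rnorm normr0. Qed.

Lemma rnorm0_eq0 x : rnorm x = 0 -> x = 0.
Proof. by move=> x0; apply/normr0_eq0; rewrite rnormE x0. Qed.

Lemma rnormN x : rnorm (- x) = rnorm x.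
Proof. by rewrite /rnorm normrN. Qed.

Lemma rnormBC x y : rnorm (x - y) = rnorm (y - x).
Proof. by rewrite -rnormN opprB. Qed.

Lemma rnormD x y : rnorm (x + y) <= rnorm x + rnorm y.
Proof.
by rewrite -lecR rmorphD/= -!rnormE ler_normD.
Qed.

Lemma rnormB x y : rnorm (x - y) <= rnorm x + rnorm y.
Proof. by rewrite -(rnormN y) rnormD. Qed.

Lemma rnormZ (c : R[i]) x : rnorm (c *: x) = complex.Re `|c| * rnorm x.
Proof.
by apply: (@complexI R); rewrite -rnormE normrZ rnormE rmorphM.
Qed.

Lemma rnormZR (r : R) x : rnorm (r%:C *: x) = `|r| * rnorm x.
Proof. by rewrite rnormZ normc_def/= expr0n/= addr0 sqrtr_sqr. Qed.

Lemma rdotDl x y z : rdot (x + y) z = rdot x z + rdot y z.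
Proof. by rewrite /rdot (linearDl (hdot : {dot H for Num.conj})) raddfD. Qed.

Lemma rdotZl (r : R) x y : rdot (r%:C *: x) y = r * rdot x y.
Proof.
rewrite /rdot (linearZl_LR (hdot : {dot H for Num.conj}))/=.
by case: (hdot x y) => u v /=; rewrite mul0r subr0.
Qed.

(** [Num.conj] belongs to the abstract numeric structure, the other conjugation is the concrete one
    on pairs; both send [c] to the element whose product with [c] is the squared modulus. *)
Lemma conjE (c : R[i]) : Num.conj c = c^*%C.
Proof.
have [->|c0] := eqVneq c 0; first by rewrite !rmorph0.
by apply: (mulfI c0); rewrite -normCK sqr_normc.
Qed.

Lemma rdotC x y : rdot x y = rdot y x.
Proof.
rewrite /rdot (hermC (hdot : {dot H for Num.conj})) expr0 mul1r.
have ReJ (c : R[i]) : complex.Re (Num.conj c) = complex.Re c.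
  by rewrite conjE; case: c.
exact: ReJ.
Qed.

Lemma rdotDr x y z : rdot z (x + y) = rdot z x + rdot z y.
Proof. by rewrite !(rdotC z) rdotDl. Qed.

Lemma rdotZr (r : R) x y : rdot x (r%:C *: y) = r * rdot x y.
Proof. by rewrite rdotC rdotZl rdotC. Qed.

Lemma rdotNl x y : rdot (- x) y = - rdot x y.
Proof. by rewrite /rdot (linearNl (hdot : {dot H for Num.conj})) raddfN. Qed.

Lemma rdotNr x y : rdot x (- y) = - rdot x y.
Proof. by rewrite rdotC rdotNl rdotC. Qed.

Lemma rdot0l x : rdot 0 x = 0.
Proof. by rewrite -[0 in LHS](subrr x) rdotDl rdotNl subrr. Qed.

Lemma rdot_suml (I : Type) (r : seq I) (P : pred I) (F : I -> H) y :
  rdot (\sum_(i <- r | P i) F i) y = \sum_(i <- r | P i) rdot (F i) y.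
Proof.
by elim/big_rec2: _ => [|i s t _ <-]; rewrite ?rdot0l// rdotDl.
Qed.

Lemma rdotxx x : rdot x x = rnorm x ^+ 2.
Proof. by rewrite /rdot -hdot_norm rnormE -rmorphXn. Qed.

Lemma rnorm_sqrD x y :
  rnorm (x + y) ^+ 2 = rnorm x ^+ 2 + 2 * rdot x y + rnorm y ^+ 2.
Proof. by rewrite -!rdotxx rdotDl !rdotDr (rdotC y x); ring. Qed.

Lemma rnorm_sqrB x y :
  rnorm (x - y) ^+ 2 = rnorm x ^+ 2 - 2 * rdot x y + rnorm y ^+ 2.
Proof. by rewrite rnorm_sqrD rdotNr rnormN mulrN. Qed.

Lemma rdot_le x y : `|rdot x y| <= rnorm x * rnorm y.
Proof.
have [->|x0] := eqVneq x 0; first by rewrite rdot0l normr0 rnorm0 mul0r.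
rewrite -ler_sqr ?nnegrE ?mulr_ge0 ?rnorm_ge0// real_normK ?num_real//.
have xx : 0 < rnorm x ^+ 2.
  by rewrite exprn_gt0// lt_def rnorm_ge0 andbT; apply: contraNneq x0 => /rnorm0_eq0 ->.
(* This vector is |x|^2 times the component of [y] orthogonal to [x]; its squared norm is p (p s -
   q^2). *)
have := sqr_ge0 (rnorm ((rnorm x ^+ 2)%:C *: y - (rdot x y)%:C *: x)).
rewrite rnorm_sqrB !rnormZR rdotZl rdotZr (rdotC y x) !exprMn.
rewrite !real_normK ?num_real//.
set p := rnorm x ^+ 2 in xx *; set q := rdot x y; set s := rnorm y ^+ 2 => h.
suff : 0 <= p * (p * s - q ^+ 2) by rewrite pmulr_rge0// subr_ge0.
by apply: le_trans h _; rewrite le_eqVlt; apply/orP; left; apply/eqP; ring.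
Qed.

Lemma rdot_ext x y : (forall z, rdot z x = rdot z y) -> x = y.
Proof.
move=> xy; apply/eqP; rewrite -subr_eq0; apply/eqP/rnorm0_eq0/eqP.
by rewrite -sqrf_eq0 -rdotxx rdotDr rdotNr xy subrr.
Qed.

(** Positive elements of [R[i]] are real, so radii in [R] suffice. *)
Lemma cvg_rnormP (T : Type) (F : set_system T) (FF : Filter F) (u : T -> H) (l : H) :
  u t @[t --> F] --> l <-> forall e : R, 0 < e -> \forall t \near F, rnorm (u t - l) < e.
Proof.
rewrite cvgrPdist_lt; split=> [h e e0|h e e0].
  have := h e%:C; rewrite ltcR => /(_ e0).
  by apply: filterS => t; rewrite rnormE ltcR rnormBC.
have := e0; rewrite ltcE/= => /andP[/eqP Ie Re].
have -> : e = (complex.Re e)%:C by rewrite RRe_real// gtr0_real.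
by have := h _ Re; apply: filterS => t; rewrite rnormE ltcR rnormBC.
Qed.

(** Completeness is phrased with filters so that it serves near-minimisers, approximate solutions
    and sums over finite subsets alike; the centre [c] may change with [e]. *)
Lemma cvg_rnorm_cauchy (T : Type) (F : set_system T) (FF : ProperFilter F) (u : T -> H) :
  (forall e : R, 0 < e -> exists c, \forall t \near F, rnorm (u t - c) < e) ->
  cvg (u t @[t --> F]).
Proof.
move=> h; apply/cauchy_cvgP; apply: cauchy_exP => e e0.
have := e0; rewrite ltcE/= => /andP[/eqP Ie Re].
have [c hc] := h _ Re; exists c.
have -> : e = (complex.Re e)%:C by rewrite RRe_real// gtr0_real.
by apply: filterS hc => t; rewrite -ball_normE/= rnormE ltcR rnormBC.
Qed.

End RealInnerProduct.

(* [Im <x, y> = Re <- i x, y>], so the real part of the dot product determines it. *)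
Lemma hdot_rdot (R : realType) (H K : hilbertType R) (u v : H) (w t : K) :
  rdot u v = rdot w t -> rdot ('i *: u) v = rdot ('i *: w) t ->
  hdot u v = hdot w t.
Proof.
rewrite /rdot.
rewrite (linearZl_LR (hdot : {dot H for Num.conj}))/=.
rewrite (linearZl_LR (hdot : {dot K for Num.conj}))/=.
case: (hdot u v) (hdot w t) => [p q] [p' q'] /= ->.
by rewrite !mul0r !mul1r !sub0r => /oppr_inj ->.
Qed.

(** * Elementary real inequalities *)

(** Evaluate at the vertex [- q / p]. When [p = 0] the function is affine, and a nonzero slope would
    let it take the value -1. *)
Lemma discriminant_le (R : realFieldType) (p q r : R) : 0 <= p ->
  (forall t, 0 <= p * t ^+ 2 + 2 * q * t + r) -> q ^+ 2 <= p * r.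
Proof.
rewrite le_eqVlt => /predU1P[<-|p0] h; last first.
  have := h (- q / p); rewrite -(pmulr_rge0 _ p0).
  suff -> : p * (p * (- q / p) ^+ 2 + 2 * q * (- q / p) + r) = p * r - q ^+ 2.
    by rewrite subr_ge0.
  by field; rewrite gt_eqF.
rewrite mul0r; have [->|q0] := eqVneq q 0; first by rewrite expr0n.
have := h (- (r + 1) / (2 * q)).
suff -> : 0 * (- (r + 1) / (2 * q)) ^+ 2 + 2 * q * (- (r + 1) / (2 * q)) + r = - 1.
  by rewrite lerNr oppr0 ler10.
by field.
Qed.

Lemma le0_epsM (R : realFieldType) (x C : R) :
  (forall e, 0 < e -> x <= e * C) -> x <= 0.
Proof.
move=> h; rewrite leNgt; apply/negP => x0.
have C1 : 0 < `|C| + 1 by rewrite ltr_wpDl.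
have /h := divr_gt0 x0 C1; apply/negP; rewrite -ltNge mulrAC ltr_pdivrMr//.
by rewrite ltr_pM2l// ltr_pwDr// ler_norm.
Qed.

(** The nonnegative quadratic in t is the sum of the (u_i t + v_i)^2. *)
Lemma sum_cauchy_schwarz (R : realFieldType) (I : Type) (s : seq I) (u v : I -> R) :
  (\sum_(i <- s) u i * v i) ^+ 2 <= (\sum_(i <- s) u i ^+ 2) * (\sum_(i <- s) v i ^+ 2).
Proof.
apply: discriminant_le => [|t]; first by apply: sumr_ge0 => i _; exact: sqr_ge0.
rewrite !(mulr_suml, mulr_sumr) -!big_split/=; apply: sumr_ge0 => i _.
have := sqr_ge0 (u i * t + v i); congr (_ <= _); ring.
Qed.

Section Linear.
Variables (R : realType) (H K : hilbertType R) (T : H -> K).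
Hypothesis linT : linear T.

Lemma linear_fun0 : T 0 = 0.
Proof. by have := linT (-1) 0 0; rewrite scaler0 addr0 scaleN1r addNr. Qed.

Lemma linear_funD x y : T (x + y) = T x + T y.
Proof. by have := linT 1 x y; rewrite !scale1r. Qed.

Lemma linear_funZ c x : T (c *: x) = c *: T x.
Proof. by have := linT c x 0; rewrite linear_fun0 !addr0. Qed.

Lemma linear_funN x : T (- x) = - T x.
Proof. by rewrite -scaleN1r linear_funZ scaleN1r. Qed.

Lemma linear_funB x y : T (x - y) = T x - T y.
Proof. by rewrite linear_funD linear_funN. Qed.

End Linear.

(** * Riesz representation of real functionals *)

Section Riesz.
Variables (R : realType) (H : hilbertType R) (phi : H -> R) (C : R).
Hypotheses (phiD : {morph phi : x y / x + y})
  (phiZ : forall (r : R) x, phi (r%:C *: x) = r * phi x)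
  (phi_bnd : forall x, `|phi x| <= C * rnorm x).

(* The representing vector minimises this functional. *)
Let energy (x : H) := rnorm x ^+ 2 - 2 * phi x.

Let energy_shift x h t : energy (x + t%:C *: h) =
  energy x + (rnorm h ^+ 2 * t ^+ 2 + 2 * (rdot x h - phi h) * t).
Proof.
rewrite /energy rnorm_sqrD rnormZR exprMn real_normK ?num_real// rdotZr phiD phiZ.
ring.
Qed.

(** Completing the square: since phi x <= C |x|, the energy is at least (|x| - C)^2 - C^2. *)
Let energy_lbound x : - C ^+ 2 <= energy x.
Proof.
rewrite /energy; have := phi_bnd x; have := ler_norm (phi x) => h1 h2.
have := le_trans h1 h2; have := sqr_ge0 (rnorm x - C).
set p := rnorm x; set q := phi x; nra.
Qed.

Let energy_inf := inf (range energy).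

Let has_inf_energy : has_inf (range energy).
Proof.
split; first by exists (energy 0), 0.
by exists (- C ^+ 2) => _ [x _ <-]; exact: energy_lbound.
Qed.

Let energy_ge x : energy_inf <= energy x.
Proof. by apply: ge_inf; [case: has_inf_energy|exists x]. Qed.

(** By the parallelogram law the energy of the midpoint is the mean of the two energies minus |x -
    y|^2 / 4, and it cannot drop below the infimum. Hence near-minimisers are close to each
    other. *)
Let energy_parallelogram x y :
  rnorm (x - y) ^+ 2 <= 2 * energy x + 2 * energy y - 4 * energy_inf.
Proof.
have := energy_ge ((2^-1)%:C *: (x + y)).
rewrite /energy rnorm_sqrB rnormZR exprMn real_normK ?num_real// rnorm_sqrD phiZ phiD.
lra.
Qed.

Lemma riesz_real : exists z, forall x, phi x = rdot x z.
Proof.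
(* The filter of near-minimisers; its limit is the representing vector. *)
pose F : set_system H := filter_from [set e : R | 0 < e]
  (fun e => [set x | energy x < energy_inf + e]).
have FF : ProperFilter F.
  apply: filter_from_proper; last first.
    move=> e /= e0; have [_ [x _ <-] hx] := inf_adherent e0 has_inf_energy.
    by exists x.
  apply: filter_from_filter; first by exists 1 => /=.
  move=> e e' /= e0 e'0; exists (Num.min e e'); first by rewrite /= lt_min e0.
  by move=> x /= hx; split; apply: (lt_le_trans hx); rewrite lerD2l ge_min lexx ?orbT.
have : cvg (x @[x --> F]).
  apply: cvg_rnorm_cauchy => e e0.
  (* Two points with energy within e^2 / 4 of the infimum are at distance less than e, by
     [energy_parallelogram]. *)
  have d0 : 0 < e ^+ 2 / 4 by rewrite divr_gt0 ?exprn_gt0.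
  have [_ [c _ <-] hc] := inf_adherent d0 has_inf_energy.
  exists c; exists (e ^+ 2 / 4) => // x /= hx.
  rewrite -ltr_sqr ?nnegrE ?rnorm_ge0 ?(ltW e0)//.
  by apply: le_lt_trans (energy_parallelogram _ _) _; lra.
move=> /cvg_ex[z /cvg_rnormP zF]; exists z => h; apply/eqP.
rewrite -subr_eq0 -normr_le0; apply: (@le0_epsM _ _ (2 * rnorm h)) => e e0.
(* Choose [x] both within e^2 of the infimum and within e of [z]. Near-minimality along the line x +
   t h bounds |<x, h> - phi h| by |h| e, and replacing [x] by [z] costs another |h| e. *)
have ee : F [set x | energy x < energy_inf + e ^+ 2].
  by exists (e ^+ 2) => //=; rewrite exprn_gt0.
have [x [/= hx xz]] := filter_ex (filterI ee (zF _ e0)).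
have : `|rdot x h - phi h| <= rnorm h * e.
  rewrite -ler_sqr ?nnegrE ?mulr_ge0 ?rnorm_ge0 ?(ltW e0)// real_normK ?num_real//.
  rewrite exprMn; apply: discriminant_le => [|t]; first exact: sqr_ge0.
  have := energy_ge (x + t%:C *: h); rewrite energy_shift; lra.
have := rdot_le (x - z) h; rewrite rdotDl rdotNl !(rdotC h).
have : rnorm (x - z) * rnorm h <= e * rnorm h by rewrite ler_wpM2r ?rnorm_ge0 ?ltW.
have := ler_distD (rdot x h) (phi h) (rdot z h).
rewrite (distrC (phi h) (rdot x h)); lra.
Qed.

End Riesz.

(** * Adjoints of bounded operators *)

Section Adjoint.
Variables (R : realType) (H K : hilbertType R).
Implicit Types T U : H -> K.

Lemma bounded_op_ge0 T : bounded_op T ->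
  exists2 C : R, 0 <= C & forall x, rnorm (T x) <= C * rnorm x.
Proof.
move=> [_ [C hC]]; exists `|C| => // x; apply: le_trans (hC x) _.
by rewrite ler_wpM2r ?rnorm_ge0// ler_norm.
Qed.

(** [riesz_real] gives the witness that the [xget] in [adjoint] needs. It only represents Re <T x,
    y>; applying it at ['i *: u] as well yields the complex identity. *)
Lemma hdot_adjoint T : bounded_op T ->
  forall x y, hdot (T x) y = hdot x (adjoint T y).
Proof.
move=> bT x y; have [linT _] := bT; have [C C0 hC] := bounded_op_ge0 bT.
have [|r u|u|z hz] := @riesz_real R H (fun x => rdot (T x) y) (C * rnorm y).
- by move=> u v; rewrite linear_funD// rdotDl.
- by rewrite linear_funZ// rdotZl.
- apply: le_trans (rdot_le _ _) _.
  by rewrite mulrAC ler_wpM2r ?rnorm_ge0.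
move: x; apply: (xgetPex 0 (P := [set z | forall x, hdot (T x) y = hdot x z])).
exists z => u; apply: hdot_rdot; first exact: hz.
by rewrite -linear_funZ// hz.
Qed.

Lemma rdot_adjoint T : bounded_op T ->
  forall x y, rdot (T x) y = rdot x (adjoint T y).
Proof. by move=> bT x y; rewrite /rdot hdot_adjoint. Qed.

Lemma adjointD T y z : bounded_op T -> adjoint T (y + z) = adjoint T y + adjoint T z.
Proof. by move=> bT; apply: rdot_ext => x; rewrite rdotDr -!rdot_adjoint// rdotDr. Qed.

Lemma adjointZ T (c : R[i]) y : bounded_op T -> adjoint T (c *: y) = c *: adjoint T y.
Proof.
move=> bT; apply: rdot_ext => x; rewrite -rdot_adjoint//.
rewrite /rdot !(linearZr_LR (hdot : {dot _ for Num.conj}))/=.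
by rewrite hdot_adjoint.
Qed.

Lemma bounded_opB T U : bounded_op T -> bounded_op U -> bounded_op (fun x => T x - U x).
Proof.
move=> [linT [C hC]] [linU [D hD]]; split.
  by move=> c x y; rewrite linT linU scalerBr opprD addrACA.
exists (C + D) => x; rewrite mulrDl; apply: le_trans (rnormB _ _) _.
exact: lerD.
Qed.

Lemma adjointB T U y : bounded_op T -> bounded_op U ->
  adjoint (fun x => T x - U x) y = adjoint T y - adjoint U y.
Proof.
move=> bT bU; apply: rdot_ext => x; rewrite -rdot_adjoint; last exact: bounded_opB.
by rewrite rdotDl rdotDr rdotNl rdotNr -!rdot_adjoint.
Qed.

Lemma bounded_opZ T (c : R[i]) : bounded_op T -> bounded_op (fun x => c *: T x).
Proof.
move=> [linT [C hC]]; split.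
  by move=> d x y; rewrite linT scalerDr !scalerA mulrC.
exists (complex.Re `|c| * C) => x; rewrite rnormZ -mulrA ler_wpM2l//.
by rewrite -ler0c RRe_real ?normr_real// normr_ge0.
Qed.

Lemma adjoint_scaleR T (r : R) y : bounded_op T ->
  adjoint (fun x => r%:C *: T x) y = r%:C *: adjoint T y.
Proof.
move=> bT; apply: rdot_ext => x; rewrite -rdot_adjoint; last exact: bounded_opZ.
by rewrite rdotZl rdotZr rdot_adjoint.
Qed.

End Adjoint.

(** * Inverses of coercive operators *)

Lemma opinv_eq (R : realType) (H : hilbertType R) (T : H -> H) x y :
  injective T -> T x = y -> opinv T y = x.
Proof.
move=> injT xy; apply: injT; rewrite xy.
by apply: (xgetPex 0 (P := [set x | T x = y])); exists x.
Qed.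

Section Coercive.
Variables (R : realType) (H : hilbertType R) (T : H -> H) (c : R).
Hypotheses (bT : bounded_op T) (c0 : 0 < c)
  (coerT : forall x, c * rnorm x ^+ 2 <= rdot (T x) x).

Let linT : linear T := bT.1.

Lemma coercive_rnorm x : c * rnorm x <= rnorm (T x).
Proof.
have [x0|x0] := eqVneq (rnorm x) 0; first by rewrite x0 mulr0 rnorm_ge0.
have xp : 0 < rnorm x by rewrite lt_def x0 rnorm_ge0.
rewrite -(ler_pM2r xp) -mulrA -expr2; apply: le_trans (coerT x) _.
exact: le_trans (ler_norm _) (rdot_le _ _).
Qed.

(* One step of Richardson's iteration [x + t (y - T x)] shrinks the residual [y - T x]. *)
Let residual_contraction : exists k t : R, [/\ 0 <= k, k < 1 &
  forall r, rnorm (r - t%:C *: T r) ^+ 2 <= k * rnorm r ^+ 2].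
Proof.
(* Adding [c] to the bound [C] makes [D] positive and gives c / D <= 1, so that the factor below is
   nonnegative. *)
have [C C0 hC] := bounded_op_ge0 bT; pose D := C + c.
have D0 : 0 < D by rewrite ltr_wpDl.
have cD : c / D <= 1 by rewrite ler_pdivrMr// mul1r lerDr.
have cD0 : 0 < c / D by rewrite divr_gt0.
(* The squared residual shrinks by at least the factor 1 - 2 t c + t^2 D^2, which is smallest at t =
   c / D^2. *)
exists (1 - (c / D) ^+ 2), (c / D ^+ 2); split.
- by rewrite subr_ge0; apply: exprn_ile1 => //; exact: ltW.
- by rewrite gtrBl exprn_gt0.
move=> r; rewrite rnorm_sqrB rnormZR exprMn real_normK ?num_real// rdotC rdotZl.
have t0 : 0 < c / D ^+ 2 by rewrite divr_gt0 ?exprn_gt0.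
have h1 : c / D ^+ 2 * (c * rnorm r ^+ 2) <= c / D ^+ 2 * rdot (T r) r by rewrite ler_pM2l.
have h2 : rnorm (T r) ^+ 2 <= D ^+ 2 * rnorm r ^+ 2.
  rewrite -exprMn ler_sqr ?nnegrE ?mulr_ge0 ?rnorm_ge0 ?(ltW D0)//.
  by apply: le_trans (hC r) _; rewrite ler_wpM2r ?rnorm_ge0// lerDl ltW.
have h3 : (c / D ^+ 2) ^+ 2 * rnorm (T r) ^+ 2 <= (c / D ^+ 2) ^+ 2 * (D ^+ 2 * rnorm r ^+ 2).
  by rewrite ler_wpM2l ?sqr_ge0.
have e1 : (c / D ^+ 2) ^+ 2 * (D ^+ 2 * rnorm r ^+ 2) = (c / D) ^+ 2 * rnorm r ^+ 2.
  by field; rewrite gt_eqF.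
have e2 : c / D ^+ 2 * (c * rnorm r ^+ 2) = (c / D) ^+ 2 * rnorm r ^+ 2.
  by field; rewrite gt_eqF.
rewrite e1 in h3; rewrite e2 in h1.
move: h1 h3; set q := _ * rdot _ _; set p := _ ^+ 2 * rnorm (T r) ^+ 2.
set s := rnorm r ^+ 2; nra.
Qed.

Let approx_solution y e : 0 < e -> exists x, rnorm (y - T x) < e.
Proof.
move=> e0; have [k [t [k0 k1 kt]]] := residual_contraction.
have step n : exists x, rnorm (y - T x) ^+ 2 <= k ^+ n * rnorm y ^+ 2.
  elim: n => [|n [x hx]].
    by exists 0; rewrite linear_fun0// subr0 expr0 mul1r.
  exists (x + t%:C *: (y - T x)).
  rewrite linear_funD// linear_funZ// opprD addrA.
  by apply: le_trans (kt _) _; rewrite [k ^+ _]exprS -mulrA ler_wpM2l.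
have /cvgrPdist_lt/(_ (e ^+ 2)) : (fun n => k ^+ n * rnorm y ^+ 2) @ \oo --> (0 : R).
  rewrite -[X in _ --> X](mul0r (rnorm y ^+ 2)).
  by apply: cvgMr_tmp; apply: cvg_expr; rewrite ger0_norm.
rewrite exprn_gt0// => /(_ isT)[n _ /(_ n (leqnn _))].
rewrite sub0r normrN ger0_norm ?mulr_ge0 ?exprn_ge0 ?rnorm_ge0// => hn.
have [x hx] := step n; exists x.
by rewrite -ltr_sqr ?nnegrE ?rnorm_ge0 ?(ltW e0)//; exact: le_lt_trans hx hn.
Qed.

(* The approximate solutions form a Cauchy filter by coercivity. *)
Lemma coercive_surj y : exists x, T x = y.
Proof.
pose F : set_system H := filter_from [set e : R | 0 < e]
  (fun e => [set x | rnorm (y - T x) < e]).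
have FF : ProperFilter F.
  apply: filter_from_proper; last by move=> e /= /(@approx_solution y).
  apply: filter_from_filter; first by exists 1 => /=.
  move=> e e' /= e0 e'0; exists (Num.min e e'); first by rewrite /= lt_min e0.
  by move=> x /=; rewrite lt_min => /andP.
have : cvg (x @[x --> F]).
  apply: cvg_rnorm_cauchy => e e0.
  (* Two residuals below c e / 2 put the images less than c e apart, hence the points less than e
     apart by [coercive_rnorm]. *)
  have d0 : 0 < c * e / 2 by rewrite divr_gt0 ?mulr_gt0.
  have [z hz] := @approx_solution y _ d0.
  exists z; exists (c * e / 2) => // x /= hx.
  rewrite -(ltr_pM2l c0); apply: le_lt_trans (coercive_rnorm _) _.
  have -> : T (x - z) = (y - T z) - (y - T x).
    by rewrite linear_funB// opprB [RHS]addrC addrA subrK.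
  by apply: le_lt_trans (rnormB _ _) _; lra.
move=> /cvg_ex[x /cvg_rnormP xF]; exists x; apply/eqP.
rewrite eq_sym -subr_eq0; apply/eqP/rnorm0_eq0/eqP; rewrite eq_le rnorm_ge0 andbT.
have [C C0 hC] := bounded_op_ge0 bT.
apply: (@le0_epsM _ _ (1 + C)) => e e0.
have ee : F [set x | rnorm (y - T x) < e] by exists e.
have [z [/= hz zx]] := filter_ex (filterI ee (xF _ e0)).
have -> : y - T x = (y - T z) + T (z - x) by rewrite linear_funB// addrA subrK.
apply: le_trans (rnormD _ _) _.
have : rnorm (T (z - x)) <= C * e by apply: le_trans (hC _) _; rewrite ler_wpM2l// ltW.
lra.
Qed.

Lemma coercive_inj : injective T.
Proof.
move=> x y xy; apply/eqP; rewrite -subr_eq0; apply/eqP/rnorm0_eq0/eqP.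
rewrite eq_le rnorm_ge0 andbT -(pmulr_rle0 _ c0).
by apply: le_trans (coercive_rnorm _) _; rewrite linear_funB// xy subrr rnorm0.
Qed.

Lemma opinvK : cancel (opinv T) T.
Proof. by move=> y; have [x xy] := coercive_surj y; rewrite (opinv_eq coercive_inj xy). Qed.

Lemma opinvVK : cancel T (opinv T).
Proof. by move=> x; apply: opinv_eq coercive_inj _. Qed.

Lemma opinv_linear : linear (opinv T).
Proof. by move=> d x y; apply: (opinv_eq coercive_inj); rewrite linT !opinvK. Qed.

Lemma opinv_le x : rnorm (opinv T x) <= c^-1 * rnorm x.
Proof.
rewrite -(ler_pM2l c0) mulVKf ?gt_eqF//.
by apply: le_trans (coercive_rnorm _) _; rewrite opinvK.
Qed.

Lemma coercive_invertible : invertible_op T.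
Proof.
split=> //; exists (opinv T); split; [|exact: opinvVK|exact: opinvK].
split; first exact: opinv_linear.
by exists c^-1; exact: opinv_le.
Qed.

End Coercive.

(** * Perturbation of a coercive operator and its Neumann series *)

Section Neumann.
Variables (R : realType) (H : hilbertType R) (S M : H -> H) (s d : R).
Hypotheses (bS : bounded_op S) (bM : bounded_op M)
  (coerS : forall x, s * rnorm x ^+ 2 <= rdot (S x) x)
  (d0 : 0 <= d) (ds : d < s) (SM : forall x, rnorm (S x - M x) <= d * rnorm x).

Let s0 : 0 < s := le_lt_trans d0 ds.
Let c0 : 0 < s - d. Proof. by rewrite subr_gt0. Qed.

Lemma perturbation_coercive x : (s - d) * rnorm x ^+ 2 <= rdot (M x) x.
Proof.
have := coerS x; have : rdot (S x - M x) x <= d * rnorm x ^+ 2.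
  apply: le_trans (ler_norm _) (le_trans (rdot_le _ _) _).
  by rewrite expr2 mulrA ler_wpM2r ?rnorm_ge0.
by rewrite rdotDl rdotNl; lra.
Qed.

Let coerM := perturbation_coercive.

(** This is the upper bound |M x| <= |S x| + |(S - M) x| read at x = M^-1 h. *)
Lemma perturbation_opinv_ge (beta : R) : 0 < beta + d ->
  (forall x, rnorm (S x) <= beta * rnorm x) ->
  forall h, (beta + d)^-1 * rnorm h <= rnorm (opinv M h).
Proof.
move=> bd0 hS h; rewrite -(ler_pM2l bd0) mulVKf ?gt_eqF//.
rewrite -{1}(opinvK bM c0 coerM h); set x := opinv M h.
have -> : M x = S x - (S x - M x) by rewrite opprB addrC subrK.
by apply: le_trans (rnormB _ _) _; rewrite mulrDl lerD.
Qed.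

Let T x := opinv S (S x - M x).

Let iter_linB n x y : iter n T (x - y) = iter n T x - iter n T y.
Proof.
elim: n => //= n ->; rewrite /T -(linear_funB (opinv_linear bS s0 coerS)).
congr (opinv S _); rewrite (linear_funB bS.1) (linear_funB bM.1).
by rewrite !opprB addrACA [RHS]addrACA; congr (_ + _); exact: addrC.
Qed.

Let rnorm_iter n x : rnorm (iter n T x) <= (d / s) ^+ n * rnorm x.
Proof.
elim: n => [|n ih] /=; first by rewrite mul1r.
apply: le_trans (opinv_le bS s0 coerS _) _.
rewrite exprS -mulrA -mulrA mulrCA ler_wpM2l ?invr_ge0 ?(ltW s0)//.
by apply: le_trans (SM _) _; rewrite ler_wpM2l.
Qed.

(* Telescoping: [S^-1 M = 1 - T], so the partial sums applied to [M x] give [x - T^n x]. *)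
Let neumann_partial_sum n y :
  \sum_(k < n) iter k T (opinv S y) - opinv M y = - iter n T (opinv M y).
Proof.
have -> : opinv S y = opinv M y - T (opinv M y).
  rewrite -{1}(opinvK bM c0 coerM y) /T (linear_funB (opinv_linear bS s0 coerS)).
  by rewrite (opinvVK bS s0 coerS) opprB addrC subrK.
elim: n => [|n ih]; first by rewrite big_ord0 sub0r.
rewrite big_ord_recr/= addrAC ih iter_linB -iterSr/=.
by rewrite addrA addNr sub0r.
Qed.

(** The n-th error is - T^n M^-1, of operator norm at most (d / s)^n / (s - d), which tends to 0
    because d < s. *)
Lemma neumann_opsum : has_opsum (fun k h => iter k T (opinv S h)) (opinv M).
Proof.
rewrite /has_opsum.
apply: (@squeeze_cvge _ _ _ _ (cst 0%E) _ (fun n => ((d / s) ^+ n * (s - d)^-1)%:E)).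
- apply: nearW => n; apply/andP; split.
    (* The unit ball contains 0, where the error vanishes, so the supremum is at least 0. *)
    apply: ereal_sup_ubound; exists 0; first by rewrite /= rnorm0 ler01.
    rewrite neumann_partial_sum (linear_fun0 (opinv_linear bM c0 coerM)).
    suff -> : iter n T 0 = 0 by rewrite oppr0 rnorm0.
    by have := iter_linB n 0 0; rewrite !subrr.
  apply: ge_ereal_sup => _ [x /= x1 <-]; rewrite lee_fin neumann_partial_sum rnormN.
  apply: le_trans (rnorm_iter _ _) _.
  rewrite ler_wpM2l ?exprn_ge0 ?divr_ge0 ?(ltW s0)//.
  apply: le_trans (opinv_le bM c0 coerM _) _.
  by rewrite -[leRHS]mulr1 ler_wpM2l ?invr_ge0 ?(ltW c0).
- exact: cvg_cst.
- apply: cvg_EFin; first exact: nearW.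
  rewrite -[X in _ --> X](mul0r (s - d)^-1).
  apply: cvgMr_tmp; apply: cvg_expr.
  by rewrite ger0_norm ?divr_ge0 ?(ltW s0)// ltr_pdivrMr// mul1r.
Qed.

End Neumann.

(** * Finite sums and the filter of finite subsets *)

Lemma ler_fsum (R : numDomainType) (I : choiceType) (F : set I) (u v : I -> R) :
  finite_set F -> (forall i, F i -> u i <= v i) ->
  \sum_(i \in F) u i <= \sum_(i \in F) v i.
Proof.
move=> finF uv; rewrite !fsbig_finite//= big_seq [leRHS]big_seq.
by apply: ler_sum => i; rewrite in_fset_set// inE => /uv.
Qed.

Lemma fsum_setD (V : nmodType) (I : choiceType) (F0 F : set I) (u : I -> V) :
  finite_set F -> F0 `<=` F ->
  \sum_(i \in F) u i = \sum_(i \in F0) u i + \sum_(i \in F `\` F0) u i.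
Proof. by move=> finF F0F; rewrite (fsbigID F0)//= setIC (setIidl F0F). Qed.

Section FiniteSubsets.
Variables (I : choiceType) (J : set I).

Lemma fsetsU (A B : set I) : fsets J A -> fsets J B -> fsets J (A `|` B).
Proof.
move=> [fA AJ] [fB BJ]; split; first by rewrite finite_setU.
by rewrite subUset.
Qed.

Lemma fsetsD (A B : set I) : fsets J A -> fsets J (A `\` B).
Proof.
move=> [fA AJ]; split; first exact: finite_setD.
by move=> i [/AJ].
Qed.

Global Instance finite_subsets_filter : ProperFilter (finite_subsets J).
Proof.
apply: filter_from_proper; last by move=> A JA; exists A; split.
apply: filter_from_filter; first by exists set0; exact: fsets_set0.
move=> A B JA JB; exists (A `|` B); first exact: fsetsU.
by move=> C [JC]; rewrite subUset => -[AC BC]; split; split.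
Qed.

Lemma finite_subsets_fsets (P : set I -> Prop) :
  (forall A, fsets J A -> P A) -> \forall A \near finite_subsets J, P A.
Proof. by move=> h; exists set0; [exact: fsets_set0|move=> A /= [/h]]. Qed.

Lemma finite_subsets_ge A : fsets J A ->
  \forall B \near finite_subsets J, fsets J B /\ A `<=` B.
Proof. by move=> JA; exists A. Qed.

End FiniteSubsets.

(** * Finite square sums of a family of operators *)

Section SquareSums.
Variables (R : realType) (J : set int) (H : hilbertType R) (K : int -> hilbertType R).
Implicit Type P : forall i : int, H -> K i.

Definition sqsum P (f : H) (F : set int) : R := \sum_(i \in F) rnorm (P i f) ^+ 2.

Lemma sqsum_ge0 P f F : 0 <= sqsum P f F.
Proof. by apply: fsumr_ge0 => i _; exact: sqr_ge0. Qed.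

Lemma le_sqsum_esum P f F : fsets J F ->
  ((sqsum P f F)%:E <= \esum_(i in J) (rnorm (P i f) ^+ 2)%:E)%E.
Proof.
move=> JF; apply: ereal_sup_ubound; exists F => //.
by rewrite fsumEFin//; case: JF.
Qed.

Lemma esum_le_sqsum P f (t : R) : (forall F, fsets J F -> sqsum P f F <= t) ->
  (\esum_(i in J) (rnorm (P i f) ^+ 2)%:E <= t%:E)%E.
Proof.
move=> h; apply: ge_ereal_sup => _ [F JF <-].
by rewrite fsumEFin; [rewrite lee_fin; exact: h|case: JF].
Qed.

Lemma g_bessel_sqsum P B : g_bessel J P B ->
  forall f F, fsets J F -> sqsum P f F <= B * rnorm f ^+ 2.
Proof.
move=> [_ _ h] f F JF; rewrite -lee_fin.
exact: le_trans (le_sqsum_esum _ _ JF) (h f).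
Qed.

Lemma g_frame_bessel P A B : g_frame J P A B -> g_bessel J P B.
Proof. by move=> [bP _ B0 h]; split=> // f; case/andP: (h f). Qed.

Lemma g_frame_sqsum P A B : g_frame J P A B -> forall f (e : R), 0 < e ->
  exists2 F, fsets J F & A * rnorm f ^+ 2 - e < sqsum P f F.
Proof.
move=> [_ _ _ h] f e e0; have /andP[hA _] := h f.
have : ((A * rnorm f ^+ 2 - e)%:E < \esum_(i in J) (rnorm (P i f) ^+ 2)%:E)%E.
  by apply: lt_le_trans hA; rewrite lte_fin gtrBl.
move=> /ereal_sup_gt[_ [F JF <-] hF]; exists F => //.
by move: hF; rewrite fsumEFin ?lte_fin//; case: JF.
Qed.

(** Let [F0] come within e of the supremum of the partial sums: whatever a larger set adds to it is
    less than e. *)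
Lemma sqsum_tail P f (t : R) : (forall F, fsets J F -> sqsum P f F <= t) ->
  forall e : R, 0 < e -> exists2 F0, fsets J F0 &
    forall F, fsets J F -> F0 `<=` F -> sqsum P f (F `\` F0) < e.
Proof.
move=> h e e0; pose E := [set sqsum P f F | F in fsets J].
have supE : has_sup E.
  split; first by exists (sqsum P f set0), set0 => //; exact: fsets_set0.
  by exists t => _ [F JF <-]; exact: h.
have [_ [F0 JF0 <-] hF0] := sup_adherent e0 supE; exists F0 => // F JF F0F.
have : sqsum P f F <= sup E by apply: ub_le_sup; [case: supE|exists F].
rewrite /sqsum (fsum_setD _ _ F0F) in hF0 *; last by case: JF.
by move: hF0; lra.
Qed.

End SquareSums.

(** * Multipliers with nonnegative real weights *)

Section MultiplierTheory.
Variables (R : realType) (J : set int) (H : hilbertType R) (K : int -> hilbertType R).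
Variables (m : int -> R[i]) (mu : int -> R) (b : R).
Hypotheses (m_mu : forall i, J i -> m i = (mu i)%:C)
  (mu_ge0 : forall i, J i -> 0 <= mu i) (mu_le : forall i, J i -> mu i <= b) (b0 : 0 <= b).
Implicit Types P Q : forall i : int, H -> K i.

Lemma rdot_multiplier_sum P Q f g F : (forall i, J i -> bounded_op (P i)) ->
  fsets J F ->
  rdot (multiplier_sum m P Q f F) g = \sum_(i \in F) mu i * rdot (Q i f) (P i g).
Proof.
move=> bP [finF FJ]; rewrite /multiplier_sum !fsbig_finite//= rdot_suml.
rewrite big_seq [RHS]big_seq; apply: eq_bigr => i.
rewrite in_fset_set// inE => /FJ Ji.
by rewrite m_mu// rdotZl (rdotC _ g) -rdot_adjoint ?(rdotC (P i g))//; exact: bP.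
Qed.

Lemma rdot_multiplier_sum_le P Q f g F : (forall i, J i -> bounded_op (P i)) ->
  fsets J F ->
  rdot (multiplier_sum m P Q f F) g <= b * Num.sqrt (sqsum Q f F * sqsum P g F).
Proof.
move=> bP JF; rewrite (rdot_multiplier_sum _ _ _ bP JF); have [finF FJ] := JF.
apply: (@le_trans _ _ (\sum_(i \in F) b * (rnorm (Q i f) * rnorm (P i g)))).
  apply: ler_fsum => // i /FJ Ji.
  have hr := le_trans (ler_norm _) (rdot_le (Q i f) (P i g)).
  apply: (@le_trans _ _ (mu i * (rnorm (Q i f) * rnorm (P i g)))).
    by rewrite ler_wpM2l ?mu_ge0.
  by rewrite ler_wpM2r ?mulr_ge0 ?rnorm_ge0 ?mu_le.
rewrite -mulr_fsumr ler_wpM2l//.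
rewrite /sqsum !fsbig_finite//=.
apply: le_trans (ler_norm _) _; rewrite -sqrtr_sqr ler_sqrt.
  exact: sum_cauchy_schwarz.
by apply: mulr_ge0; apply: sumr_ge0 => i _; exact: sqr_ge0.
Qed.

(** Test the sum x against itself: |x|^2 <= b sqrt(t B) |x|, then divide by |x|. Keeping the square
    sum of [Q] at [f] as a separate [t] allows small tails, for convergence, and the exact frame sum
    of [The], for its lower frame bound. *)
Lemma multiplier_sum_le P Q f F (B t : R) : g_bessel J P B ->
  fsets J F -> sqsum Q f F <= t ->
  rnorm (multiplier_sum m P Q f F) <= b * Num.sqrt (B * t).
Proof.
move=> PB JF ht; have [bP B0 _] := PB; set x := multiplier_sum _ _ _ _ _.
have t0 : 0 <= t := le_trans (sqsum_ge0 _ _ _) ht.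
have [->|x0] := eqVneq (rnorm x) 0; first by rewrite mulr_ge0 ?sqrtr_ge0.
have xp : 0 < rnorm x by rewrite lt_def x0 rnorm_ge0.
rewrite -(ler_pM2r xp) -expr2 -rdotxx.
apply: le_trans (rdot_multiplier_sum_le _ _ _ bP JF) _.
rewrite -mulrA ler_wpM2l//.
have -> : Num.sqrt (B * t) * rnorm x = Num.sqrt (t * (B * rnorm x ^+ 2)).
  rewrite mulrA (mulrC t) [in RHS]sqrtrM ?mulr_ge0 ?(ltW B0)//.
  by rewrite sqrtr_sqr ger0_norm ?(ltW xp).
rewrite ler_sqrt; last by apply: mulr_ge0 => //; apply: mulr_ge0; rewrite ?sqr_ge0 ?ltW.
by rewrite ler_pM ?sqsum_ge0//; exact: g_bessel_sqsum PB _ _ JF.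
Qed.

Lemma multiplier_sum_cvg P Q f (B t : R) : g_bessel J P B ->
  (forall F, fsets J F -> sqsum Q f F <= t) ->
  cvg (multiplier_sum m P Q f @ finite_subsets J).
Proof.
move=> PB Qt; have [bP B0 _] := PB.
apply: cvg_rnorm_cauchy => e e0.
(* Chosen so that b sqrt(B dlt) < e; the + 1 keeps the denominator positive when [b = 0] and the
   inequality strict. *)
pose dlt := e ^+ 2 / ((b ^+ 2 + 1) * B).
have dlt0 : 0 < dlt by rewrite divr_gt0 ?mulr_gt0 ?exprn_gt0// ltr_wpDl ?sqr_ge0.
have [F0 JF0 hF0] := sqsum_tail Qt dlt0.
exists (multiplier_sum m P Q f F0).
apply: filterS (finite_subsets_ge JF0) => F [JF F0F].
rewrite {1}/multiplier_sum (fsum_setD _ _ F0F); last by case: JF.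
rewrite addrC addKr.
apply: le_lt_trans (multiplier_sum_le PB (fsetsD _ JF) (ltW (hF0 _ JF F0F))) _.
rewrite -ltr_sqr ?nnegrE ?mulr_ge0 ?sqrtr_ge0 ?(ltW e0)//.
rewrite exprMn sqr_sqrtr; last by apply: mulr_ge0; exact: ltW.
have -> : b ^+ 2 * (B * dlt) = e ^+ 2 * (b ^+ 2 / (b ^+ 2 + 1)).
  have b1 : b ^+ 2 + 1 != 0 by rewrite gt_eqF// ltr_wpDl ?sqr_ge0.
  by rewrite /dlt; field; rewrite b1 gt_eqF.
have b1 : 0 < b ^+ 2 + 1 by rewrite ltr_wpDl ?sqr_ge0.
by rewrite gtr_pMr ?exprn_gt0// ltr_pdivrMr// mul1r ltrDl ltr01.
Qed.

Lemma multiplier_eq P Q f l :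
  multiplier_sum m P Q f F @[F --> finite_subsets J] --> l -> multiplier J m P Q f = l.
Proof. by move=> /(cvg_lim (@norm_hausdorff _ _)). Qed.

Lemma cvg_multiplier P Q f (B t : R) : g_bessel J P B ->
  (forall F, fsets J F -> sqsum Q f F <= t) ->
  multiplier_sum m P Q f F @[F --> finite_subsets J] --> multiplier J m P Q f.
Proof. by move=> PB Qt; have := multiplier_sum_cvg PB Qt. Qed.

Lemma multiplier_le P Q f (B t : R) : g_bessel J P B ->
  (forall F, fsets J F -> sqsum Q f F <= t) ->
  rnorm (multiplier J m P Q f) <= b * Num.sqrt (B * t).
Proof.
move=> PB Qt; rewrite -subr_le0; apply: (@le0_epsM _ _ 1) => e e0.
have /cvg_rnormP/(_ _ e0) := cvg_multiplier PB Qt.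
move=> /(filterI (finite_subsets_ge (fsets_set0 J)))/filter_ex[F [[JF _] hF]].
have := multiplier_sum_le PB JF (Qt F JF).
have := rnormB (multiplier_sum m P Q f F) (multiplier_sum m P Q f F - multiplier J m P Q f).
by rewrite opprB addrC subrK; lra.
Qed.

Lemma multiplier_bounded P Q (B C : R) : g_bessel J P B -> g_bessel J Q C ->
  bounded_op (multiplier J m P Q) /\
  forall f, rnorm (multiplier J m P Q f) <= b * Num.sqrt (B * C) * rnorm f.
Proof.
move=> PB QC; have [bP B0 _] := PB; have [bQ C0 _] := QC.
have le f : rnorm (multiplier J m P Q f) <= b * Num.sqrt (B * C) * rnorm f.
  apply: le_trans (multiplier_le PB (g_bessel_sqsum QC f)) _.
  rewrite mulrA sqrtrM ?mulr_ge0 ?(ltW B0) ?(ltW C0)//.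
  by rewrite sqrtr_sqr ger0_norm ?rnorm_ge0// mulrA.
split=> //; split; last by exists (b * Num.sqrt (B * C)).
move=> c f g; apply: multiplier_eq.
have hf := cvg_multiplier PB (g_bessel_sqsum QC f).
have hg := cvg_multiplier PB (g_bessel_sqsum QC g).
apply: cvg_trans (cvgD (cvgZl_tmp (k := c) hf) hg).
apply: near_eq_cvg; apply: finite_subsets_fsets => F [finF FJ] /=.
rewrite [LHS](_ : _ = c *: multiplier_sum m P Q f F + multiplier_sum m P Q g F)//.
rewrite /multiplier_sum !fsbig_finite//= scaler_sumr -big_split/=.
rewrite big_seq [RHS]big_seq; apply: eq_bigr => i.
rewrite in_fset_set// inE => /FJ Ji.
rewrite (bQ _ Ji).1 adjointD ?adjointZ; try exact: bP.
by rewrite scalerDr !scalerA mulrC.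
Qed.

Lemma multiplier_coercive P (A B a : R) : g_frame J P A B -> 0 <= a ->
  (forall i, J i -> a <= mu i) ->
  forall f, a * A * rnorm f ^+ 2 <= rdot (multiplier J m P P f) f.
Proof.
move=> PAB a0 a_mu f; have PB := g_frame_bessel PAB; have [bP _ _] := PB.
(* The error has two sources: the finite square sum may miss A |f|^2 by e, which is weighted by [a],
   and the finite multiplier sum is within e of its limit, which is paired with [f]. *)
rewrite -subr_le0; apply: (@le0_epsM _ _ (a + rnorm f)) => e e0.
have [F0 JF0 hF0] := g_frame_sqsum PAB f e0.
have /cvg_rnormP/(_ _ e0) := cvg_multiplier PB (g_bessel_sqsum PB f).
move=> /(filterI (finite_subsets_ge JF0))/filter_ex[F [[JF F0F] hF]].
set x := multiplier_sum m P P f F in hF; set y := multiplier J m P P f in hF *.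
have h1 : a * sqsum P f F <= rdot x f.
  rewrite (rdot_multiplier_sum _ _ _ bP JF) mulr_fsumr; apply: ler_fsum; first by case: JF.
  by move=> i Fi; rewrite rdotxx ler_wpM2r ?sqr_ge0// a_mu//; case: JF => _; apply.
have h2 : sqsum P f F0 <= sqsum P f F.
  rewrite /sqsum (fsum_setD _ _ F0F); last by case: JF.
  by rewrite lerDl sqsum_ge0.
have h3 : rdot (x - y) f <= e * rnorm f.
  apply: le_trans (ler_norm _) (le_trans (rdot_le _ _) _).
  by rewrite ler_wpM2r ?rnorm_ge0 ?ltW.
have h4 : a * (A * rnorm f ^+ 2 - e) <= a * sqsum P f F.
  by rewrite ler_wpM2l// (le_trans _ h2)// ltW.
by move: h3 h1 h4; rewrite rdotDl rdotNl; lra.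
Qed.

(** Stated as a convergence because it is used twice: to show that the multiplier of [Q] converges
    and to compute its limit. *)
Lemma multiplier_subr P Q Q' (B C D : R) f : g_bessel J P B -> g_bessel J Q' C ->
  g_bessel J (fun i x => Q i x - Q' i x) D ->
  multiplier_sum m P Q f F @[F --> finite_subsets J] -->
  multiplier J m P Q' f + multiplier J m P (fun i x => Q i x - Q' i x) f.
Proof.
move=> PB QC QD; have [bP _ _] := PB.
have hf := cvg_multiplier PB (g_bessel_sqsum QC f).
have hg := cvg_multiplier PB (g_bessel_sqsum QD f).
apply: cvg_trans (cvgD hf hg).
apply: near_eq_cvg; apply: finite_subsets_fsets => F [finF FJ].
rewrite [LHS](_ : _ = multiplier_sum m P Q' f F + multiplier_sum m P
  (fun i x => Q i x - Q' i x) f F)//.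
rewrite /multiplier_sum !fsbig_finite//= -big_split/=.
rewrite big_seq [RHS]big_seq; apply: eq_bigr => i.
rewrite in_fset_set// inE => /FJ Ji.
rewrite -scalerDr -adjointD; last exact: bP.
by rewrite addrC subrK.
Qed.

Lemma multiplier_subl P P' Q (B C D : R) f : (forall i, J i -> bounded_op (P i)) ->
  g_bessel J P' B -> g_bessel J (fun i x => P i x - P' i x) C -> g_bessel J Q D ->
  multiplier_sum m P Q f F @[F --> finite_subsets J] -->
  multiplier J m P' Q f + multiplier J m (fun i x => P i x - P' i x) Q f.
Proof.
move=> bP PB PC QD; have [bP' _ _] := PB.
have hf := cvg_multiplier PB (g_bessel_sqsum QD f).
have hg := cvg_multiplier PC (g_bessel_sqsum QD f).
apply: cvg_trans (cvgD hf hg).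
apply: near_eq_cvg; apply: finite_subsets_fsets => F [finF FJ].
rewrite [LHS](_ : _ = multiplier_sum m P' Q f F + multiplier_sum m
  (fun i x => P i x - P' i x) Q f F)//.
rewrite /multiplier_sum !fsbig_finite//= -big_split/=.
rewrite big_seq [RHS]big_seq; apply: eq_bigr => i.
rewrite in_fset_set// inE => /FJ Ji.
rewrite -scalerDr adjointB; [|exact: bP|exact: bP'].
by rewrite addrC subrK.
Qed.

(** A nonnegative weight has a real square root, which comes out of the adjoint unconjugated and
    multiplies the other root to give [w i]. The weights [w] and [m] agree only on [J]: for negative
    sequences they are [|m i|] and [- m i]. *)
Lemma frame_op_sqrt P (B : R) (w : int -> R[i]) : g_bessel J P B ->
  (forall i, J i -> w i = (mu i)%:C) ->
  frame_op J (scaled_family (fun i => sqrtC (w i)) P) = multiplier J m P P.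
Proof.
move=> PB w_mu; have [bP _ _] := PB; apply/funext => f.
apply: (cvg_lim (@norm_hausdorff _ _)).
apply: cvg_trans (cvg_multiplier PB (g_bessel_sqsum PB f)).
apply: near_eq_cvg; apply: finite_subsets_fsets => F [finF FJ].
rewrite /multiplier_sum !fsbig_finite//=.
rewrite big_seq [RHS]big_seq; apply: eq_bigr => i.
rewrite in_fset_set// inE => /FJ Ji.
have w0 : 0 <= w i by rewrite w_mu// ler0c mu_ge0.
rewrite /scaled_family m_mu// -w_mu//.
have := sqrtCK (w i); have : 0 <= sqrtC (w i) by rewrite sqrtC_ge0.
move=> /ger0_real/RRe_real; set r := complex.Re _ => <- <-.
rewrite adjoint_scaleR; last exact: bP.
by rewrite adjointZ ?scalerA//; exact: bP.
Qed.

End MultiplierTheory.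

(** * Change of sign *)

Lemma multiplierN (R : realType) (J : set int) (H : hilbertType R)
    (K : int -> hilbertType R) (m : int -> R[i]) (P Q : forall i : int, H -> K i) :
  multiplier_cvg J m P Q ->
  multiplier_cvg J (fun i => - m i) P Q /\
  multiplier J (fun i => - m i) P Q = (fun f => - multiplier J m P Q f).
Proof.
move=> cvgm.
have h f : multiplier_sum (fun i => - m i) P Q f F @[F --> finite_subsets J] -->
    - multiplier J m P Q f.
  apply: cvg_trans (cvgN (cvgm f)).
  apply: near_eq_cvg; apply: finite_subsets_fsets => F [finF FJ].
  rewrite [LHS](_ : _ = - multiplier_sum m P Q f F)//.
  rewrite /multiplier_sum !fsbig_finite//= -sumrN.
  by apply: eq_bigr => i _; rewrite scaleNr.
split=> [f|]; first by apply/cvg_ex; eexists; exact: h.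
by apply/funext => f; exact: multiplier_eq (h f).
Qed.

Section NegatedOperator.
Variables (R : realType) (H : hilbertType R) (T : H -> H).
Hypothesis invT : invertible_op T.

Lemma invertible_opN : invertible_op (fun x => - T x).
Proof.
have [[linT [C hC]] [U [[linU [D hD]] TU UT]]] := invT.
split.
  split; first by move=> c x y; rewrite linT opprD scalerN.
  by exists C => x; rewrite rnormN.
exists (fun y => U (- y)); split.
- split; last by exists D => y; apply: le_trans (hD _) _; rewrite rnormN.
  by move=> c x y; rewrite opprD -scalerN linU.
- by move=> x; rewrite opprK TU.
- by move=> y; rewrite UT opprK.
Qed.

Lemma opinvN : opinv (fun x => - T x) = (fun h => - opinv T h).
Proof.
have [bT [U [bU TU UT]]] := invT; have injT := can_inj TU.
apply/funext => h; rewrite (opinv_eq injT (UT h)).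
apply: opinv_eq; first by move=> x y /oppr_inj/injT.
by rewrite linear_funN ?UT ?opprK//; case: bT.
Qed.

End NegatedOperator.

(** * The perturbation estimates for positive weights *)

Section PositiveWeights.
Variables (R : realType) (J : set int) (H : hilbertType R) (K : int -> hilbertType R).
Variables (Lam The : forall i : int, H -> K i) (A B BD : R).
Variables (m : int -> R[i]) (mu : int -> R) (a b : R).
Hypotheses (Lam_frame : g_frame J Lam A B)
  (The_bounded : forall i, J i -> bounded_op (The i))
  (D_bessel : g_bessel J (fun i f => The i f - Lam i f) BD)
  (m_mu : forall i, J i -> m i = (mu i)%:C)
  (a0 : 0 < a) (ab : a <= b)
  (mu_bnd : forall i, J i -> a <= mu i <= b)
  (ba_lt : b / a < A / Num.sqrt (BD * B)).

Let S := multiplier J m Lam Lam.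
Let d := b * Num.sqrt (B * BD).
Let D := fun i f => The i f - Lam i f.

Let b0 : 0 < b := lt_le_trans a0 ab.
Let A0 : 0 < A. Proof. by case: Lam_frame. Qed.
Let B0 : 0 < B. Proof. by case: Lam_frame. Qed.
Let BD0 : 0 < BD. Proof. by case: D_bessel. Qed.
Let mu_ge0 i : J i -> 0 <= mu i.
Proof. by move=> /mu_bnd/andP[h _]; apply: le_trans h; exact: ltW. Qed.
Let mu_le i : J i -> mu i <= b. Proof. by move=> /mu_bnd/andP[]. Qed.
Let a_mu i : J i -> a <= mu i. Proof. by move=> /mu_bnd/andP[]. Qed.
Let Lam_bessel : g_bessel J Lam B := g_frame_bessel Lam_frame.

Let d0 : 0 < d. Proof. by rewrite mulr_gt0 ?sqrtr_gt0 ?mulr_gt0. Qed.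

Let daA : d < a * A.
Proof.
have s0 : 0 < Num.sqrt (BD * B) by rewrite sqrtr_gt0 mulr_gt0.
by move: ba_lt; rewrite ltr_pdivrMr// mulrAC ltr_pdivlMr// mulrC /d (mulrC BD) (mulrC A) mulrC.
Qed.

(** From (x + y)^2 <= 2 x^2 + 2 y^2. A crude bound is enough here, since the sharp constants come
    from the difference [D]. *)
Lemma The_bessel : g_bessel J The (2 * B + 2 * BD).
Proof.
split=> // [|f]; first by rewrite addr_gt0 ?mulr_gt0.
apply: esum_le_sqsum => F JF.
have hL := g_bessel_sqsum Lam_bessel f JF; have hD := g_bessel_sqsum D_bessel f JF.
apply: (@le_trans _ _ (2 * sqsum Lam f F + 2 * sqsum D f F)); last first.
  by move: hL hD; lra.
rewrite /sqsum !mulr_fsumr -fsbig_split/=; last by case: JF.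
apply: ler_fsum => [|i Fi]; first by case: JF.
have -> : The i f = Lam i f + D i f by rewrite /D addrC subrK.
have := rnormD (Lam i f) (D i f).
set x := rnorm (Lam i f); set y := rnorm (D i f) => xy.
apply: (@le_trans _ _ ((x + y) ^+ 2)).
  by rewrite ler_sqr ?nnegrE ?addr_ge0 ?rnorm_ge0.
by have := sqr_ge0 (x - y); nra.
Qed.

Let bounds P Q C1 C2 :=
  @multiplier_bounded R J H K m mu b m_mu mu_ge0 mu_le (ltW b0) P Q C1 C2.

Let coerS f : a * A * rnorm f ^+ 2 <= rdot (S f) f.
Proof. exact: (multiplier_coercive m_mu mu_ge0 mu_le (ltW b0) Lam_frame (ltW a0) a_mu). Qed.

Let bS : bounded_op S := (bounds Lam_bessel Lam_bessel).1.

Let leS f : rnorm (S f) <= b * B * rnorm f.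
Proof.
apply: le_trans ((bounds Lam_bessel Lam_bessel).2 f) _.
by rewrite -expr2 sqrtr_sqr gtr0_norm.
Qed.

Lemma multiplier_LamThe : [/\ multiplier_cvg J m Lam The,
  bounded_op (multiplier J m Lam The) &
  forall f, rnorm (S f - multiplier J m Lam The f) <= d * rnorm f].
Proof.
have h f := multiplier_subr m_mu mu_ge0 mu_le (ltW b0) (f := f) Lam_bessel Lam_bessel D_bessel.
split=> [f||f]; first by apply/cvg_ex; eexists; exact: h.
  exact: (bounds Lam_bessel The_bessel).1.
rewrite (multiplier_eq (h f)) opprD addrA subrr sub0r rnormN.
exact: (bounds Lam_bessel D_bessel).2.
Qed.

(** The difference of the families now sits under the adjoint; the estimate is the previous one with
    [B] and [BD] exchanged, and d is symmetric in them. *)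
Lemma multiplier_TheLam : [/\ multiplier_cvg J m The Lam,
  bounded_op (multiplier J m The Lam) &
  forall f, rnorm (S f - multiplier J m The Lam f) <= d * rnorm f].
Proof.
have h f := multiplier_subl m_mu mu_ge0 mu_le (ltW b0) (f := f) The_bounded Lam_bessel
  D_bessel Lam_bessel.
split=> [f||f]; first by apply/cvg_ex; eexists; exact: h.
  exact: (bounds The_bessel Lam_bessel).1.
rewrite (multiplier_eq (h f)) opprD addrA subrr sub0r rnormN /d (mulrC B).
exact: (bounds D_bessel Lam_bessel).2.
Qed.

(** [M] stays abstract so that both multipliers are covered. In the lower estimate, [b * B] is the
    bound b sqrt(B B) on [S]. *)
Lemma perturbed_frame_op (M : H -> H) : bounded_op M ->
  (forall f, rnorm (S f - M f) <= d * rnorm f) ->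
  [/\ invertible_op M,
      forall h, 1 / (b * B + d) * rnorm h <= rnorm (opinv M h) <=
        1 / (a * A - d) * rnorm h &
      has_opsum (fun k h => iter k (fun x => opinv S (S x - M x)) (opinv S h))
        (opinv M)].
Proof.
move=> bM SM; have dc : 0 < a * A - d by rewrite subr_gt0.
have coerM := perturbation_coercive coerS SM.
split; first exact: coercive_invertible bM dc coerM.
  move=> h; rewrite !div1r (opinv_le bM dc coerM) andbT.
  apply: (perturbation_opinv_ge bM coerS daA SM) => //.
  by rewrite addr_gt0// mulr_gt0.
exact: (neumann_opsum bS bM coerS (ltW d0) daA SM).
Qed.

(* The lower frame bound comes from [|M f| <= b sqrt B (sum |The_i f|^2)^(1/2)]
   and the coercivity of [M = multiplier J m Lam The]. *)
Lemma The_g_frame : is_g_frame J The.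
Proof.
have [_ bM SM] := multiplier_LamThe; have dc : 0 < a * A - d by rewrite subr_gt0.
(* [c] is read off by squaring (a A - d) |f| <= |M f| <= b sqrt(B t), with t the frame sum of [The]
   at f. *)
have [_ BT0 The_le] := The_bessel; pose c := (a * A - d) ^+ 2 / (b ^+ 2 * B).
exists c, (2 * B + 2 * BD); split=> //.
  by rewrite divr_gt0 ?mulr_gt0 ?exprn_gt0.
move=> f; rewrite The_le andbT; set s := esum _ _.
have s0 : (0 <= s)%E by apply: esum_ge0 => i _; rewrite lee_fin sqr_ge0.
(* The Bessel bound makes the sum finite, so it can serve as the real number [t] in
   [multiplier_le]. *)
have sfin : s \is a fin_num by rewrite ge0_fin_numE// (le_lt_trans (The_le f)) ?ltry.
rewrite -(fineK sfin) lee_fin; set t := fine s.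
have t0 : 0 <= t by exact: fine_ge0.
have hF F : fsets J F -> sqsum The f F <= t.
  by move=> JF; rewrite -lee_fin fineK//; exact: le_sqsum_esum.
have h1 := coercive_rnorm (perturbation_coercive coerS SM) f.
have h2 := multiplier_le m_mu mu_ge0 mu_le (ltW b0) Lam_bessel hF.
have : ((a * A - d) * rnorm f) ^+ 2 <= (b * Num.sqrt (B * t)) ^+ 2.
  rewrite ler_sqr ?nnegrE; first exact: le_trans h1 h2.
    by apply: mulr_ge0; [exact: ltW|exact: rnorm_ge0].
  by apply: mulr_ge0; [exact: ltW|exact: sqrtr_ge0].
rewrite !exprMn sqr_sqrtr; last by apply: mulr_ge0; first exact: ltW.
move=> h; rewrite /c mulrAC ler_pdivrMr; last by rewrite mulr_gt0// exprn_gt0.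
by rewrite [leRHS]mulrC -[leRHS]mulrA.
Qed.

End PositiveWeights.

Theorem proposition3p6 (R : realType) (J : set int) (H : hilbertType R)
    (K : int -> hilbertType R)
    (sepH : separable H) (sepK : forall i, J i -> separable (K i))
    (Lam The : forall i : int, H -> K i) (A B BD : R)
    (Lam_frame : g_frame J Lam A B)
    (The_bounded : forall i, J i -> bounded_op (The i))
    (D_bessel : g_bessel J (fun i f => The i f - Lam i f) BD)
    (BD_lt : BD < A ^+ 2 / B)
    (m : int -> R[i]) (a b : R)
    (m_sign : positive_seq J m \/ negative_seq J m)
    (m_sn : semi_normalized J m a b)
    (ba_lt : b / a < A / Num.sqrt (BD * B)) :
  let M1 : H -> H := multiplier J m Lam The in
  let M2 : H -> H := multiplier J m The Lam in
  let Spos : H -> H := frame_op J (scaled_family (fun i => sqrtC (m i)) Lam) in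
  let Sabs : H -> H := frame_op J (scaled_family (fun i => sqrtC `|m i|) Lam) in
  let lo : R := 1 / (b * B + b * Num.sqrt (B * BD)) in
  let up : R := 1 / (a * A - b * Num.sqrt (B * BD)) in
  [/\ is_g_frame J The,
      [/\ multiplier_cvg J m Lam The, invertible_op M1 &
          forall h : H,
            lo * rnorm h <= rnorm (opinv M1 h) <= up * rnorm h],
      [/\ multiplier_cvg J m The Lam, invertible_op M2 &
          forall h : H,
            lo * rnorm h <= rnorm (opinv M2 h) <= up * rnorm h],
      positive_seq J m ->
        has_opsum
          (fun k h => iter k (fun x => opinv Spos (Spos x - M1 x))
                             (opinv Spos h))
          (opinv M1) /\
        has_opsum
          (fun k h => iter k (fun x => opinv Spos (Spos x - M2 x))
                             (opinv Spos h))
          (opinv M2) &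
      negative_seq J m ->
        has_opsum
          (fun k h => iter k (fun x => opinv Sabs (Sabs x + M1 x))
                             (opinv Sabs h))
          (fun h => - opinv M1 h) /\
        has_opsum
          (fun k h => iter k (fun x => opinv Sabs (Sabs x + M2 x))
                             (opinv Sabs h))
          (fun h => - opinv M2 h)].
Proof.
move=> M1 M2 Spos Sabs lo up; have [a0 ab m_bnd] := m_sn.
have b0 : 0 <= b := ltW (lt_le_trans a0 ab).
have Lam_bessel := g_frame_bessel Lam_frame.
have re_bnd (z : R[i]) : 0 < z -> a <= rnorm z <= b ->
    z = (complex.Re z)%:C /\ a <= complex.Re z <= b.
  move=> z0; rewrite /rnorm gtr0_norm// => ->.
  by rewrite RRe_real// gtr0_real.
pose estimate M := forall h : H, lo * rnorm h <= rnorm (opinv M h) <= up * rnorm h.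
(* [w] weights the multipliers and [v] stands under the square root in the frame operator, so that
   one statement serves both (m, m) and (- m, |m|). *)
have pos (w v : int -> R[i]) : (forall i, J i -> 0 < w i) ->
    (forall i, J i -> v i = w i) ->
    (forall i, J i -> a <= rnorm (w i) <= b) ->
  let S := frame_op J (scaled_family (fun i => sqrtC (v i)) Lam) in
  let P M := [/\ invertible_op M, estimate M &
    has_opsum (fun k h => iter k (fun x => opinv S (S x - M x)) (opinv S h)) (opinv M)] in
  [/\ is_g_frame J The,
      multiplier_cvg J w Lam The /\ P (multiplier J w Lam The) &
      multiplier_cvg J w The Lam /\ P (multiplier J w The Lam)].
  move=> w0 vw w_bnd S P; pose mu i := complex.Re (w i).
  have w_mu i : J i -> w i = (mu i)%:C.
    by move=> Ji; have [] := re_bnd _ (w0 i Ji) (w_bnd i Ji).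
  have mu_bnd i : J i -> a <= mu i <= b.
    by move=> Ji; have [] := re_bnd _ (w0 i Ji) (w_bnd i Ji).
  have mu_ge0 i : J i -> 0 <= mu i.
    by move=> /mu_bnd/andP[h _]; apply: le_trans h; exact: ltW.
  have mu_le i : J i -> mu i <= b by move=> /mu_bnd/andP[].
  have [cvg1 b1 S1] := multiplier_LamThe Lam_frame The_bounded D_bessel w_mu a0 ab mu_bnd.
  have [cvg2 b2 S2] := multiplier_TheLam Lam_frame The_bounded D_bessel w_mu a0 ab mu_bnd.
  have frame_opE : S = multiplier J w Lam Lam.
    apply: (frame_op_sqrt w_mu mu_ge0 mu_le b0 Lam_bessel) => i Ji.
    by rewrite vw// w_mu.
  split.
  - exact: (The_g_frame Lam_frame The_bounded D_bessel w_mu a0 ab mu_bnd ba_lt).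
  - split; first exact: cvg1.
    rewrite /P frame_opE.
    exact: (perturbed_frame_op Lam_frame D_bessel w_mu a0 ab mu_bnd ba_lt b1 S1).
  - split; first exact: cvg2.
    rewrite /P frame_opE.
    exact: (perturbed_frame_op Lam_frame D_bessel w_mu a0 ab mu_bnd ba_lt b2 S2).
have neg : (forall i, J i -> m i < 0) ->
  let P M := [/\ invertible_op M, estimate M &
    has_opsum (fun k h => iter k (fun x => opinv Sabs (Sabs x + M x)) (opinv Sabs h))
      (fun h => - opinv M h)] in
  [/\ is_g_frame J The, multiplier_cvg J m Lam The /\ P M1 &
      multiplier_cvg J m The Lam /\ P M2].
  move=> m0 P.
  (* With T the multiplier of [- m] and M = - T, one has Sabs + M = Sabs - T and - M^-1 = T^-1, so
     the series claimed for [m] is literally the one known for [- m]. *)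
  have negP Q Q' : let T := multiplier J (fun i => - m i) Q Q' in
      multiplier_cvg J (fun i => - m i) Q Q' /\ [/\ invertible_op T, estimate T &
        has_opsum (fun k h => iter k (fun x => opinv Sabs (Sabs x - T x)) (opinv Sabs h))
          (opinv T)] ->
      multiplier_cvg J m Q Q' /\ P (multiplier J m Q Q').
    move=> T [cvgT [invT estT sumT]].
    have mNN : (fun i => - - m i) = m by apply/funext => i; rewrite opprK.
    have [] := multiplierN cvgT; rewrite mNN => cvgm ->; split; first exact: cvgm.
    split; first exact: invertible_opN.
      by move=> h; rewrite (opinvN invT) rnormN; exact: estT.
    rewrite (opinvN invT).
    have -> : (fun h => - - opinv T h) = opinv T by apply/funext => h; rewrite opprK.
    exact: sumT.
  have [|||gT P1 P2] := pos (fun i => - m i) (fun i => `|m i|).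
  - by move=> i Ji; rewrite oppr_gt0 m0.
  - by move=> i Ji; rewrite ltr0_norm// m0.
  - by move=> i Ji; rewrite /rnorm normrN; exact: m_bnd.
  by split; [exact: gT|exact: negP P1|exact: negP P2].
split.
- by case: m_sign => [p|n]; [have [] := pos m m p (fun _ _ => erefl) m_bnd|have [] := neg n].
- case: m_sign => [p|n].
    by have [_ [c [i e _]] _] := pos m m p (fun _ _ => erefl) m_bnd.
  by have [_ [c [i e _]] _] := neg n.
- case: m_sign => [p|n].
    by have [_ _ [c [i e _]]] := pos m m p (fun _ _ => erefl) m_bnd.
  by have [_ _ [c [i e _]]] := neg n.
- move=> p; have [_ [_ [_ _ s1]] [_ [_ _ s2]]] := pos m m p (fun _ _ => erefl) m_bnd.
  by split; [exact: s1|exact: s2].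
- move=> n; have [_ [_ [_ _ s1]] [_ [_ _ s2]]] := neg n.
  by split; [exact: s1|exact: s2].
Qed.
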